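(* Let $\theta>0$ and let $\langle\cdot\rangle'_{n;\theta}$ denote expectation with respect to the probability measure $M'_{n;\theta}$ on $\mathbb Y_n$. For any $F\in\mathcal A_\theta$, $\langle F\rangle'_{n;\theta}=\sum_{\lambda\in\mathbb Y_n}F(\lambda)M'_{n;\theta}(\lambda)$ is a polynomial in $n$ of degree at most $\deg F$ (degree with respect to the filtration of $\mathcal A_\theta$).
   Context: $\mathbb Y$: Young diagrams; $\mathbb Y_n$: those with $n$ boxes; $\lambda_i$ row lengths, $\ell(\lambda)$ number of nonzero rows. $\mathcal A_\theta$ is the unital $\mathbb R$-algebra of functions on $\mathbb Y$ generated by the algebraically independent functions $p^*_{m;\theta}(\lambda)=\sum_{i=1}^{\ell(\lambda)}[(\lambda_i-\theta i)^m-(-\theta i)^m]$, $m\ge1$, filtered by $\deg p^*_{m;\theta}=m$. Kerov coordinates: draw $\lambda$ in English convention (rows downward, columns rightward); the border of $\lambda$ has $2d-1$ corners $(r_k,s_k)$ ordered along the path from $+\infty$ on the horizontal axis to $+\infty$ on the vertical axis, odd $k$ being inner corners and even $k$ outer corners; $x_i=s_{2i-1}-\theta r_{2i-1}$ ($1\le i\le d$), $y_j=s_{2j}-\theta r_{2j}$ ($1\le j\le d-1$). Let $\pi^\uparrow_i(\lambda)=\prod_{j=1}^{d-1}(x_i-y_j)/\prod_{l\ne i}(x_i-x_l)$; these are positive and sum to $1$. The inner corner $(r_{2i-1},s_{2i-1})$ corresponds to the box $\square_i$ in row $r_{2i-1}+1$, column $s_{2i-1}+1$, which can be added to $\lambda$;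 the diagrams $\nu$ with $\nu\searrow\lambda$ (obtained from $\lambda$ by adding one box) are exactly $\lambda\cup\square_i$, $1\le i\le d$. Set $p^\uparrow_{n;\theta}(\lambda,\lambda\cup\square_i)=\pi^\uparrow_i(\lambda)$ for $\lambda\in\mathbb Y_n$. The measures $M'_{n;\theta}$ on $\mathbb Y_n$ are defined by $M'_{0;\theta}(\varnothing)=1$ and $M'_{n+1;\theta}(\nu)=\sum_{\lambda\in\mathbb Y_n:\,\lambda\nearrow\nu}M'_{n;\theta}(\lambda)p^\uparrow_{n;\theta}(\lambda,\nu)$. *)

(* Defs.v *)
From HB Require Import structures.
From mathcomp Require Import all_boot all_order all_algebra.
Set Implicit Arguments. Unset Strict Implicit. Unset Printing Implicit Defensive.
Import Order.TTheory GRing.Theory Num.Theory.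
Local Open Scope ring_scope.

(* A Young diagram is encoded by its sequence of (nonzero) row lengths
   lambda_1 >= lambda_2 >= ... >= lambda_l > 0 (row i is at index i-1). *)
Definition is_partition (l : seq nat) : bool :=
  sorted geq l && all (fun x => (0 < x)%N) l.

Fixpoint cands (N k : nat) : seq (seq nat) :=
  if k is k'.+1 then [::] :: [seq i :: l | i <- iota 1 N, l <- cands N k']
  else [:: [::]].

Definition Yn (n : nat) : seq (seq nat) :=
  [seq l <- cands n n | is_partition l && (sumn l == n)].

(* 0-indexed rows i where a box can be added (box in row i, column lambda_i,
   0-indexed); these correspond to the inner corners (r,s) = (i, lambda_i). *)
Definition addable (l : seq nat) : seq nat :=
  [seq i <- iota 0 (size l).+1 | (i == 0)%N || (nth 0%N l i < nth 0%N l i.-1)%N].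

(* 0-indexed rows i whose last box is removable; these correspond to the
   outer corners (r,s) = (i+1, lambda_i). *)
Definition removable (l : seq nat) : seq nat :=
  [seq i <- iota 0 (size l) | (nth 0%N l i.+1 < nth 0%N l i)%N].

(* Kerov coordinates x = s - theta r (inner corners), y = s - theta r (outer). *)
Definition kx (R : numFieldType) (theta : R) (l : seq nat) (i : nat) : R :=
  (nth 0%N l i)%:R - theta * i%:R.
Definition ky (R : numFieldType) (theta : R) (l : seq nat) (j : nat) : R :=
  (nth 0%N l j)%:R - theta * j.+1%:R.

Definition pi_up (R : numFieldType) (theta : R) (l : seq nat) (i : nat) : R :=
  (\prod_(j <- removable l) (kx theta l i - ky theta l j))
  / (\prod_(k <- addable l | k != i) (kx theta l i - kx theta l k)).

(* The measures M'_{n;theta}, as functions on all sequences (supported on Y_n).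
   lambda \cup box_i is incr_nth lambda i. *)
Fixpoint Mprime (R : numFieldType) (theta : R) (n : nat) (nu : seq nat) : R :=
  match n with
  | 0 => (nu == [::])%:R
  | n'.+1 => \sum_(lam <- Yn n') \sum_(i <- addable lam | incr_nth lam i == nu)
               Mprime theta n' lam * pi_up theta lam i
  end.

Definition expect (R : numFieldType) (theta : R) (n : nat) (F : seq nat -> R) : R :=
  \sum_(lam <- Yn n) F lam * Mprime theta n lam.

Definition pstar (R : numFieldType) (theta : R) (m : nat) (l : seq nat) : R :=
  \sum_(i < size l) (((nth 0%N l i)%:R - theta * (i.+1)%:R) ^+ m
                     - (- (theta * (i.+1)%:R)) ^+ m).

(* inA theta d F : F lies in the filtration piece A_theta^{<= d}, i.e. the
   span of monomials in the p*_m (weight m) of total weight <= d. *)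
Inductive inA (R : numFieldType) (theta : R) : nat -> (seq nat -> R) -> Prop :=
| inA_const d (c : R) : inA theta d (fun _ => c)
| inA_gen m : (0 < m)%N -> inA theta m (pstar theta m)
| inA_add d F G : inA theta d F -> inA theta d G -> inA theta d (fun l => F l + G l)
| inA_scale d (c : R) F : inA theta d F -> inA theta d (fun l => c * F l)
| inA_mul d1 d2 F G : inA theta d1 F -> inA theta d2 G ->
    inA theta (d1 + d2) (fun l => F l * G l)
| inA_mono d d' F : (d <= d')%N -> inA theta d F -> inA theta d' F.

(* Main.v *)
(* Write (U F)(l) for the average of F over the diagrams covering l,
   with weights pi_up; then <F>_{n+1} = <U F>_n, so it is enough that U - 1
   lowers the degree by one. Adding a box at the inner corner x changes p*_m by
   a polynomial in x of degree m - 1, so (U F - F)(l) is a combination of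
   moments h_k = sum_i pi_i x_i^k with total degree less than deg F. Newton's
   identities k h_k = sum_{1 <= j <= k} p_j h_{k-j}, with
   p_j = sum x_i^j - sum y_i^j, show that h_k has degree at most k, because
   p_j is a combination of p*_1, ..., p*_{j-1}. *)
Require Import Defs.
From HB Require Import structures.
From mathcomp Require Import all_boot all_order all_algebra.
From mathcomp Require Import ring zify.
Set Implicit Arguments. Unset Strict Implicit. Unset Printing Implicit Defensive.
Import Order.TTheory GRing.Theory Num.Theory.
Local Open Scope ring_scope.

(** * Newton identities for the moments of a rational function *)

(* The coefficient of z^-(k+1) in the expansion at infinity of
   prod_(y <- t) (z - y) / prod_(i <- s) (z - x i), when size t < size s. *)
Definition moment (K : fieldType) (I : eqType) (x : I -> K) (s : seq I)
    (t : seq K) (k : nat) : K :=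
  \sum_(i <- s) (\prod_(y <- t) (x i - y))
                / (\prod_(j <- s | j != i) (x i - x j)) * x i ^+ k.

Lemma moment_perm (K : fieldType) (I : eqType) (x : I -> K) (s s' : seq I)
    (t : seq K) (k : nat) :
  perm_eq s s' -> moment x s t k = moment x s' t k.
Proof.
move=> ss'; rewrite /moment (perm_big _ ss') /=; apply: eq_bigr => i _.
by rewrite (perm_big _ ss').
Qed.

Lemma moment_cons_zero (K : fieldType) (I : eqType) (x : I -> K) (s : seq I)
    (y : K) (t : seq K) (k : nat) :
  moment x s (y :: t) k = moment x s t k.+1 - y * moment x s t k.
Proof.
rewrite /moment mulr_sumr -sumrB; apply: eq_bigr => i _.
rewrite big_cons exprS; ring.
Qed.

(** Multiplying the rational function by z - [x a] cancels the pole at [x a]. On the right the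
    summand of [a] drops out, and in the others the factor [x i - x a], nonzero by injectivity,
    cancels. *)
Lemma moment_cons_pole (K : fieldType) (I : eqType) (x : I -> K) (a : I)
    (s : seq I) (t : seq K) (k : nat) :
  uniq (a :: s) -> {in a :: s &, injective x} ->
  moment x s t k = moment x (a :: s) t k.+1 - x a * moment x (a :: s) t k.
Proof.
move=> /= /andP[as_ us] injx; rewrite /moment mulr_sumr -sumrB big_cons.
rewrite exprS mulrCA subrr add0r; apply: eq_big_seq => i si.
have ai : a != i by apply: contraNneq as_ => ->.
rewrite big_cons ai.
have xia : x i - x a != 0.
  rewrite subr_eq0; apply: contra_neq ai => /injx ->//; rewrite inE ?eqxx//.
  by rewrite si orbT.
rewrite exprS invfM.
set P := \prod_(y <- t) _; set D := (\prod_(j <- s | _) _)^-1.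
rewrite -[in LHS](mulr1 P) -(mulfV xia); ring.
Qed.

(** At infinity the rational function behaves like z^-(size s - size t), so the first coefficient
    that can be nonzero is 1. Zeros are stripped off first, then poles. *)
Lemma moment_initial (K : fieldType) (I : eqType) (x : I -> K) (s : seq I)
    (t : seq K) (k : nat) :
  uniq s -> {in s &, injective x} -> (size t + k < size s)%N ->
  moment x s t k = (size s == (size t + k).+1)%:R.
Proof.
move=> us injx; elim: t k => [|y t IHt] k; last first.
  move=> /= ltks; rewrite moment_cons_zero !IHt ?addnS ?addSn; try lia.
  rewrite [_ == (size t + k).+1]gtn_eqF ?mulr0 ?subr0//; lia.
(* The induction is on a bound for the number of poles, because the case k = 0 needs the hypothesis
   for [a :: s] as well as for [b :: s]. *)
rewrite add0n; have [n le_sn] := ubnP (size s).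
elim: n s us injx k le_sn => // n IHn [//|a s] us injx k lesn.
have us' : uniq s by case/andP: us.
have injs : {in s &, injective x}.
  by move=> u v us_ vs_; apply: injx; rewrite inE ?us_ ?vs_ orbT.
elim: k => [_|k IHk ltk].
  case: s us injx lesn us' injs => [|b s] us injx lesn us' injs.
    rewrite /moment big_seq1 big_nil big_cons eqxx /= big_nil.
    by rewrite invr1 !mulr1.
  have perm_ab : perm_eq [:: b, a & s] [:: a, b & s].
    by rewrite (perm_catCA [:: b] [:: a] s).
  have uas : uniq [:: b, a & s] by rewrite (perm_uniq perm_ab).
  have injba : {in [:: b, a & s] &, injective x}.
    by move=> u v; rewrite !(perm_mem perm_ab); apply: injx.
  (* Cancelling [a] and cancelling [b] give the same value by induction, so [x a - x b] times the
     zeroth moment is 0. *)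
  have /= := moment_cons_pole [::] 0 us injx.
  have /= := moment_cons_pole [::] 0 uas injba.
  rewrite !(moment_perm x _ _ perm_ab).
  have uas' : uniq (a :: s) by case/andP: uas.
  have injas : {in a :: s &, injective x}.
    by move=> u v us_ vs_; apply: injba; rewrite inE ?us_ ?vs_ orbT.
  rewrite (IHn (a :: s)) ?(IHn (b :: s)) //.
  move=> -> e; have {e} /eqP : (x a - x b) * moment x [:: a, b & s] [::] 0 = 0.
    apply: (addrI (moment x [:: a, b & s] [::] 1
      - x a * moment x [:: a, b & s] [::] 0)).
    by rewrite addr0 -[RHS]e; ring.
  rewrite mulf_eq0 subr_eq0 => /orP[/eqP/injx|/eqP->//].
  rewrite !inE !eqxx orbT => /(_ isT isT) eab.
  by move: us; rewrite eab /= inE eqxx.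
have := moment_cons_pole [::] k us injx.
move=> /(congr1 (fun z => z + x a * moment x (a :: s) [::] k)).
rewrite subrK => <-; rewrite IHk 1?ltnW// IHn//=.
by rewrite (gtn_eqF ltk) mulr0 addr0.
Qed.

(** For formal series f = sum M_k z^-(k+1) and L = sum p_j z^-(j+1), this is the coefficient of
    z^-(k+2) in L f + f'. It vanishes when L = -f'/f, which for a rational function makes p_j the
    power sum of the poles minus that of the zeros. *)
Definition newton_defect (K : pzRingType) (M p : nat -> K) (k : nat) : K :=
  \sum_(j < k.+1) p j * M (k - j)%N - k.+1%:R * M k.

(** Passing from f to g = (z - y) f turns L into L - 1/(z - y), and L f + f' is multiplied by z - y.
    The condition M_0 = 0 keeps g free of a constant term. *)
Lemma newton_defect_step (K : comPzRingType) (M p M' p' : nat -> K) (y : K) :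
  M 0%N = 0 -> (forall k, M' k = M k.+1 - y * M k) ->
  (forall j, p' j = p j - y ^+ j) ->
  forall k, newton_defect M' p' k =
            newton_defect M p k.+1 - y * newton_defect M p k.
Proof.
move=> M0 M'E p'E k; rewrite /newton_defect.
(* Coefficient form of g / (z - y) = f. *)
have tele : \sum_(j < k.+1) y ^+ j * (M (k - j).+1 - y * M (k - j)%N) = M k.+1.
  rewrite -(big_mkord xpredT (fun j => y ^+ j * (M (k - j).+1 - y * M (k - j)%N))).
  rewrite (eq_big_nat _ _ (F2 := fun j => - (y ^+ j.+1 * M (k.+1 - j.+1)%N)
      - - (y ^+ j * M (k.+1 - j)%N))); last first.
    move=> j /andP[_ ltjk]; rewrite subSS exprS subSn//; ring.
  by rewrite telescope_sumr// subnn M0 mulr0 subn0 expr0 mul1r oppr0 add0r opprK.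
rewrite (eq_bigr (fun j : 'I_k.+1 => (p j * M (k.+1 - j)%N - y * (p j * M (k - j)%N))
   - y ^+ j * (M (k - j).+1 - y * M (k - j)%N))); last first.
  move=> j _; rewrite M'E p'E subSn ?leq_ord//; ring.
rewrite sumrB tele sumrB -mulr_sumr M'E [in RHS]big_ord_recr /= subnn M0 mulr0.
rewrite [in RHS](mulrSr 1 k.+1); ring.
Qed.

Lemma newton_moment (K : fieldType) (I : eqType) (x : I -> K) (s : seq I)
    (t : seq K) (k : nat) :
  uniq s -> {in s &, injective x} -> (size t < size s)%N ->
  newton_defect (moment x s t)
    (fun j => \sum_(i <- s) x i ^+ j - \sum_(y <- t) y ^+ j) k = 0.
Proof.
move=> us injx; elim: t k => [k _|y t IHt k /= lts]; last first.
  rewrite (newton_defect_step (M := moment x s t) (y := y)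
    (p := fun j => \sum_(i <- s) x i ^+ j - \sum_(y <- t) y ^+ j)).
  - by rewrite !IHt ?(ltnW lts)// mulr0 subr0.
  - rewrite moment_initial ?addn0 ?(ltnW lts)//.
    by rewrite gtn_eqF.
  - by move=> m; rewrite moment_cons_zero.
  - by move=> j; rewrite big_cons; ring.
elim: s us injx k => [|a [|b s] IHs] us injx k.
- by rewrite /newton_defect big1 /moment ?big_nil ?mulr0 ?subr0// => i _;
    rewrite !big_nil mulr0.
(* A single pole has M_0 = 1, outside the scope of [newton_defect_step]; here each of the k + 1
   products equals [x a ^+ k]. *)
- rewrite /newton_defect.
  have mE m : moment x [:: a] [::] m = x a ^+ m.
    by rewrite /moment big_seq1 big_nil big_cons eqxx big_nil invr1 !mul1r.
  rewrite (eq_bigr (fun=> x a ^+ k)); last first.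
    move=> j _; rewrite big_seq1 big_nil subr0 mE -exprD subnKC//.
    exact: leq_ord.
  by rewrite mE sumr_const card_ord mulr_natl subrr.
have us' : uniq (b :: s) by case/andP: us.
have injs : {in b :: s &, injective x}.
  by move=> u v us_ vs_; apply: injx; rewrite inE ?us_ ?vs_ orbT.
have M0 : moment x [:: a, b & s] [::] 0 = 0 by rewrite moment_initial.
(* The step lemma is read backwards: since the defect of [b :: s] vanishes, vanishing for
   [[:: a, b & s]] passes from k to k + 1. *)
elim: k => [|k IHk].
  by rewrite /newton_defect big_ord_recl big_ord0 /= M0 !mulr0 subr0 addr0.
have := newton_defect_step (y := x a)
  (p := fun j => \sum_(i <- [:: a, b & s]) x i ^+ j - \sum_(y <- [::]) y ^+ j)
  (M' := moment x (b :: s) [::])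
  (p' := fun j => \sum_(i <- b :: s) x i ^+ j - \sum_(y <- [::]) y ^+ j) M0 _ _ k.
rewrite IHk mulr0 subr0 IHs// => <- //.
- by move=> m; apply: moment_cons_pole.
- by move=> j; rewrite [in RHS]big_cons; ring.
Qed.

(** * Adding a box to a diagram *)

Lemma partition_nth_anti (l : seq nat) (i j : nat) :
  is_partition l -> (i <= j)%N -> (nth 0%N l j <= nth 0%N l i)%N.
Proof.
case/andP=> sl _ leij; case: (ltnP j (size l)) => [ltj|/(nth_default 0%N)->//].
have geq_tr : transitive geq by move=> a b c ab bc; apply: leq_trans bc ab.
apply: (sorted_leq_nth geq_tr) => //; first exact: leqnn.
by rewrite inE (leq_ltn_trans leij).
Qed.

Lemma partition_incr_nth (l : seq nat) (i : nat) :
  is_partition l -> i \in addable l -> is_partition (incr_nth l i).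
Proof.
move=> pl; rewrite mem_filter mem_iota /= add0n ltnS => /andP[addi lei].
have mono := partition_nth_anti pl.
apply/andP; split.
  apply/(sortedP 0%N) => j _; rewrite /= !nth_incr_nth.
  have := mono j j.+1 (leqnSn j).
  case: (eqVneq i j.+1) => [eij|_] /=; last lia.
  by move: addi; rewrite eij /=; lia.
apply/(all_nthP 0%N) => j; rewrite size_incr_nth nth_incr_nth.
case: (eqVneq i j) => //= ij ltj.
have ltjl : (j < size l)%N by case: ifP ltj; lia.
by case/andP: pl => _ /(all_nthP 0%N)/(_ j ltjl).
Qed.

Lemma sumn_incr_nth (l : seq nat) (i : nat) :
  sumn (incr_nth l i) = (sumn l).+1.
Proof.
elim: l i => [|x l IHl] [|i] //=; last by rewrite IHl addnS.
by rewrite sumn_ncons mul0n.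
Qed.

Lemma mem_cands (N k : nat) (l : seq nat) :
  (size l <= k)%N -> all (fun x => 0 < x <= N)%N l -> l \in cands N k.
Proof.
elim: k l => [|k IHk] [|x l] //= lk /andP[xN lN]; rewrite inE /=.
apply/allpairsP; exists (x, l); split=> //=; first by rewrite mem_iota; lia.
exact: IHk.
Qed.

Lemma cands_uniq (N k : nat) : uniq (cands N k).
Proof.
elim: k => //= k IHk; apply/andP; split.
  by apply/negP => /allpairsP[[x l] []].
by apply: allpairs_uniq (iota_uniq _ _) IHk _ => -[x l] [y m] _ _ /= [-> ->].
Qed.

(** The bounds in [cands n n] lose nothing: positive parts with sum n are at most n in number and at
    most n in size. *)
Lemma mem_Yn (n : nat) (l : seq nat) :
  (l \in Yn n) = is_partition l && (sumn l == n).
Proof.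
rewrite mem_filter; apply: andb_idr => /andP[/andP[_ pos] /eqP <-].
apply: mem_cands; elim: l pos => //= x l IHl /andP[x0 pos].
  by have := IHl pos; lia.
have := IHl pos; rewrite x0 leq_addr /=; apply: sub_all => y /andP[-> /= yl].
exact: leq_trans yl (leq_addl _ _).
Qed.

Lemma Yn_uniq (n : nat) : uniq (Yn n).
Proof. exact: filter_uniq (cands_uniq n n). Qed.

(** Supplies the count of one more pole than zeros: row i + 1 accepts a box exactly when row i can
    lose one. *)
Lemma addable_removable (l : seq nat) :
  addable l = 0%N :: map S (removable l).
Proof.
rewrite /addable /removable /= -[1%N]addn0 iotaDl filter_map.
by congr (_ :: map _ _); apply: eq_filter.
Qed.

Lemma addable_uniq (l : seq nat) : uniq (addable l).
Proof. exact: filter_uniq (iota_uniq _ _). Qed.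

(** Row lengths weakly decrease and [theta * i] strictly increases, so [kx] is strictly
    decreasing. *)
Lemma kx_inj (R : realFieldType) (theta : R) (l : seq nat) :
  0 < theta -> is_partition l -> injective (kx theta l).
Proof.
move=> th pl; have lt_kx i j : (i < j)%N -> kx theta l j < kx theta l i.
  move=> ltij; rewrite /kx; apply: ler_ltB.
    by rewrite ler_nat partition_nth_anti// ltnW.
  by rewrite ltr_pM2l// ltr_nat.
move=> i j eij; case: (ltngtP i j) => // /lt_kx; by rewrite eij ltxx.
Qed.

Lemma expectS (R : numFieldType) (theta : R) (n : nat) (F : seq nat -> R) :
  expect theta n.+1 F =
  \sum_(l <- Yn n) Mprime theta n l *
    \sum_(i <- addable l) pi_up theta l i * F (incr_nth l i).
Proof.
rewrite /expect /=.
under eq_bigr do rewrite mulr_sumr.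
rewrite exchange_big /=; apply: eq_big_seq => l.
rewrite mem_Yn => /andP[pl /eqP ln].
under eq_bigr do rewrite big_mkcond mulr_sumr.
rewrite exchange_big mulr_sumr /=; apply: eq_big_seq => i li.
(* For fixed [l] and [i] only the diagram [incr_nth l i] contributes, and it is listed exactly
   once. *)
rewrite (bigD1_seq (incr_nth l i)) ?Yn_uniq //=; last first.
  by rewrite mem_Yn partition_incr_nth // sumn_incr_nth ln eqxx.
rewrite eqxx big1 ?addr0; first by ring.
by move=> nu /negbTE; rewrite eq_sym => ->; rewrite mulr0.
Qed.

(* Rows that are not corners contribute [kx (i + 1) = ky i], so the power sums
   over corners extend to all rows. *)
Lemma kerov_power_sum (R : numFieldType) (theta : R) (l : seq nat) (k : nat) :
  is_partition l ->
  \sum_(i <- addable l) kx theta l i ^+ k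
    - \sum_(y <- map (ky theta l) (removable l)) y ^+ k =
  0 ^+ k + \sum_(j < k) (theta ^+ (k - j) *+ 'C(k, j)) * pstar theta j l.
Proof.
move=> pl; have rowE : \sum_(i <- addable l) kx theta l i ^+ k
    - \sum_(y <- map (ky theta l) (removable l)) y ^+ k =
    kx theta l 0 ^+ k
    + \sum_(i < size l) (kx theta l i.+1 ^+ k - ky theta l i ^+ k).
  rewrite addable_removable big_cons !big_map -addrA -sumrB big_filter.
  rewrite -(big_mkord xpredT
    (fun i => kx theta l i.+1 ^+ k - ky theta l i ^+ k)) /index_iota subn0.
  congr (_ + _); rewrite big_mkcond /=; apply: eq_bigr => i _.
  case: ifPn => //; rewrite -leqNgt => le.
  have e : nth 0%N l i = nth 0%N l i.+1.
    by apply/eqP; rewrite eqn_leq le partition_nth_anti.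
  by rewrite /kx /ky e subrr.
(* The sum runs over one row past the end, where [kx] is [- (theta * (size l)%:R)]; telescoping
   trades this last term for [0 ^+ k]. *)
have kxE : kx theta l 0 ^+ k + \sum_(i < size l) kx theta l i.+1 ^+ k =
    0 ^+ k + \sum_(i < size l) (kx theta l i ^+ k
      + ((- (theta * i.+1%:R)) ^+ k - (- (theta * i%:R)) ^+ k)).
  rewrite big_split /= -(big_mkord xpredT (fun i =>
    (- (theta * i.+1%:R)) ^+ k - (- (theta * i%:R)) ^+ k)) telescope_sumr//.
  rewrite -(big_ord_recl (size l) (fun i => kx theta l i ^+ k)) big_ord_recr /=.
  rewrite [kx theta l (size l)]/kx nth_default// sub0r mulr0 oppr0; ring.
rewrite rowE sumrB addrA kxE -addrA -sumrB; congr (_ + _).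
under [RHS]eq_bigr do rewrite /pstar mulr_sumr.
rewrite [RHS]exchange_big /=; apply: eq_bigr => i _.
(* The top binomial term cancels, leaving j < k. It is applied with [a] equal to [ky theta l i],
   where [a + theta] is [kx theta l i], and with [a] equal to [- (theta * i.+1%:R)]. *)
have binE a : (a + theta) ^+ k - a ^+ k =
    \sum_(j < k) (theta ^+ (k - j) *+ 'C(k, j)) * a ^+ j.
  rewrite [a + _]addrC exprDn big_ord_recr /= subnn binn mulr1n mul1r addrK.
  by apply: eq_bigr => j _; rewrite mulrnAl.
under [RHS]eq_bigr do rewrite mulrBr.
rewrite sumrB -!binE /kx /ky.
rewrite (_ : - (theta * i%:R) = - (theta * i.+1%:R) + theta); last first.
  by rewrite [i.+1%:R]mulrSr; ring.
rewrite [_ + (_ + theta)]addrA; ring.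
Qed.

(** * Moments of the transition probabilities *)

(** [inA] concerns functions on all sequences and has no clause for pointwise equality, while the
    moment identities are proved on partitions. Equality there suffices for expectations. *)
Definition inA_on_partitions (R : numFieldType) (theta : R) (d : nat)
    (F : seq nat -> R) : Prop :=
  exists2 G, inA theta d G & forall l, is_partition l -> F l = G l.

Section InAOnPartitions.
Variables (R : numFieldType) (theta : R).
Implicit Types (F G : seq nat -> R) (d : nat).
Local Notation inAp := (inA_on_partitions theta).

Lemma inAp_inA d F : inA theta d F -> inAp d F.
Proof. by exists F. Qed.

Lemma inAp_ext d F G :
  (forall l, is_partition l -> F l = G l) -> inAp d G -> inAp d F.
Proof. by move=> FG [H AH GH]; exists H => // l pl; rewrite FG ?GH. Qed.

Lemma inAp_mono d d' F : (d <= d')%N -> inAp d F -> inAp d' F.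
Proof. by move=> dd' [H AH FH]; exists H => //; apply: inA_mono AH. Qed.

Lemma inAp_add d F G : inAp d F -> inAp d G -> inAp d (fun l => F l + G l).
Proof.
move=> [F' AF FF'] [G' AG GG']; exists (fun l => F' l + G' l).
  exact: inA_add.
by move=> l pl; rewrite FF' ?GG'.
Qed.

Lemma inAp_scale d c F : inAp d F -> inAp d (fun l => c * F l).
Proof.
move=> [F' AF FF']; exists (fun l => c * F' l); first exact: inA_scale.
by move=> l pl; rewrite FF'.
Qed.

Lemma inAp_mul d d' F G :
  inAp d F -> inAp d' G -> inAp (d + d') (fun l => F l * G l).
Proof.
move=> [F' AF FF'] [G' AG GG']; exists (fun l => F' l * G' l).
  exact: inA_mul.
by move=> l pl; rewrite FF' ?GG'.
Qed.

Lemma inAp_sum d n (F : nat -> seq nat -> R) :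
  (forall i, (i < n)%N -> inAp d (F i)) -> inAp d (fun l => \sum_(i < n) F i l).
Proof.
elim: n => [|n IHn] AF.
  apply: (inAp_ext (G := fun=> 0)); first by move=> l _; rewrite big_ord0.
  exact/inAp_inA/inA_const.
apply: (inAp_ext (G := fun l => \sum_(i < n) F i l + F n l)).
  by move=> l _; rewrite big_ord_recr.
by apply: inAp_add; [apply: IHn => i ltin; apply/AF/ltnW | apply: AF].
Qed.

(** Includes m = 0, which occurs in the expansion of the Kerov power sums and gives the zero
    function. *)
Lemma inAp_pstar m : inAp m (pstar theta m).
Proof.
case: m => [|m]; last exact/inAp_inA/inA_gen.
apply: (inAp_ext (G := fun=> 0)); last exact/inAp_inA/inA_const.
by move=> l _; rewrite /pstar big1// => i _; rewrite !expr0 subrr.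
Qed.

End InAOnPartitions.

Definition up_moment (R : numFieldType) (theta : R) (k : nat) (l : seq nat) : R :=
  \sum_(i <- addable l) pi_up theta l i * kx theta l i ^+ k.

Lemma up_momentE (R : numFieldType) (theta : R) (k : nat) (l : seq nat) :
  up_moment theta k l =
  moment (kx theta l) (addable l) (map (ky theta l) (removable l)) k.
Proof. by apply: eq_bigr => i _; rewrite big_map. Qed.

(** The transition weights sum to 1: with one more pole than zeros, the rational function starts
    with 1/z. *)
Lemma up_moment0 (R : realFieldType) (theta : R) (l : seq nat) :
  0 < theta -> is_partition l -> up_moment theta 0 l = 1.
Proof.
move=> th pl; rewrite up_momentE moment_initial ?addable_uniq//.
- by rewrite addable_removable /= !size_map addn0 eqxx.
- by move=> i j _ _; apply: kx_inj.
- by rewrite addable_removable /= !size_map addn0.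
Qed.

Lemma up_moment_newton (R : realFieldType) (theta : R) (k : nat) (l : seq nat) :
  0 < theta -> is_partition l ->
  k.+1%:R * up_moment theta k.+1 l =
  \sum_(j < k.+1)
    (\sum_(i < j.+1) (theta ^+ (j.+1 - i) *+ 'C(j.+1, i)) * pstar theta i l)
    * up_moment theta (k - j) l.
Proof.
move=> th pl.
have := @newton_moment _ _ (kx theta l) (addable l)
  (map (ky theta l) (removable l)) k.+1 (addable_uniq l).
(* At index k + 1 the term j = 0 has p_0 = 1 and cancels one of the k + 2 copies of h_(k+1). *)
rewrite /newton_defect big_ord_recl kerov_power_sum // big_ord0 expr0 addr0.
rewrite mul1r subn0 [k.+2%:R]mulrS mulrDl mul1r opprD addrACA subrr add0r.
rewrite -!up_momentE => /(_ _ _)/eqP; rewrite subr_eq0 => /(_ _ _)/eqP <-.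
- apply: eq_bigr => j _; rewrite lift0 kerov_power_sum// exprS mul0r add0r.
  by rewrite up_momentE subSS.
- by move=> i j _ _; apply: kx_inj.
- by rewrite addable_removable /= !size_map.
Qed.

(** Strong induction through the Newton identity: p_(j+1) is taken in degree j + 1 and h_(k-j) in
    degree k - j, so every product stays within k + 1. *)
Lemma inAp_up_moment (R : realFieldType) (theta : R) (k : nat) :
  0 < theta -> inA_on_partitions theta k (up_moment theta k).
Proof.
move=> th; have [n] := ubnP k; elim: n k => // n IHn [|k] ltkn.
  apply: (inAp_ext (G := fun=> 1)); last exact/inAp_inA/inA_const.
  by move=> l pl; apply: up_moment0.
apply: (inAp_ext (G := fun l => k.+1%:R^-1 * (\sum_(j < k.+1)
    (\sum_(i < j.+1) (theta ^+ (j.+1 - i) *+ 'C(j.+1, i)) * pstar theta i l)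
    * up_moment theta (k - j) l))).
  by move=> l pl; rewrite -up_moment_newton// mulKf// pnatr_eq0.
apply: inAp_scale; apply: (inAp_sum (F := fun j l =>
    (\sum_(i < j.+1) (theta ^+ (j.+1 - i) *+ 'C(j.+1, i)) * pstar theta i l)
    * up_moment theta (k - j) l)) => j ltjk.
apply: (inAp_mono (d := j.+1 + (k - j))); first lia.
apply: inAp_mul; last by apply: IHn; lia.
apply: (inAp_sum (F := fun i l =>
   (theta ^+ (j.+1 - i) *+ 'C(j.+1, i)) * pstar theta i l)) => i ltij.
by apply/inAp_scale/(inAp_mono (ltnW ltij))/inAp_pstar.
Qed.

(** * The averaging operator lowers the degree *)

(* Polynomials in x over A_theta whose total degree is strictly less than [d];
   thus only 0 for [d = 0]. *)
Inductive corner_poly (R : numFieldType) (theta : R) (d : nat) :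
    (seq nat -> R -> R) -> Prop :=
| corner_poly0 : corner_poly theta d (fun _ _ => 0)
| corner_poly_monomial a k G : inA theta a G -> (a + k < d)%N ->
    corner_poly theta d (fun l x => G l * x ^+ k)
| corner_polyD H H' : corner_poly theta d H -> corner_poly theta d H' ->
    corner_poly theta d (fun l x => H l x + H' l x)
| corner_poly_ext H H' : (forall l x, H l x = H' l x) ->
    corner_poly theta d H' -> corner_poly theta d H.

Section CornerPoly.
Variables (R : numFieldType) (theta : R).
Implicit Types (F : seq nat -> R) (H : seq nat -> R -> R) (d : nat).
Local Notation corner_poly := (corner_poly theta).

Lemma corner_poly_mono d d' H :
  (d <= d')%N -> corner_poly d H -> corner_poly d' H.
Proof.
move=> dd'; elim=> {H} [|a k G AG lt|H H' _ BH _ BH'|H H' HH' _ BH'].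
- exact: corner_poly0.
- exact: corner_poly_monomial AG (leq_trans lt dd').
- exact: corner_polyD.
- exact: corner_poly_ext HH' BH'.
Qed.

Lemma corner_poly_mull d d' F H :
  inA theta d F -> corner_poly d' H ->
  corner_poly (d + d') (fun l x => F l * H l x).
Proof.
move=> AF; elim=> {H} [|a k G AG lt|H H' _ BH _ BH'|H H' HH' _ BH'].
- by apply: corner_poly_ext (corner_poly0 _ _) => l x; rewrite mulr0.
- have AFG := inA_mul AF AG.
  have /(corner_poly_monomial AFG) B : (d + a + k < d + d')%N by lia.
  by apply: corner_poly_ext B => l x; rewrite mulrA.
- by apply: corner_poly_ext (corner_polyD BH BH') => l x; rewrite mulrDr.
- by apply: corner_poly_ext BH' => l x; rewrite HH'.
Qed.

Lemma corner_poly_mul d d' H H' :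
  corner_poly d H -> corner_poly d' H' ->
  corner_poly (d + d') (fun l x => H l x * H' l x).
Proof.
move=> + BH'; elim=> {H} [|a k G AG lt|H1 H2 _ BH1 _ BH2|H1 H2 HH' _ BH].
- by apply: corner_poly_ext (corner_poly0 _ _) => l x; rewrite mul0r.
- elim: BH' => {H'} [|b m G' AG' lt'|H1 H2 _ BH1 _ BH2|H1 H2 HH' _ BH].
  + by apply: corner_poly_ext (corner_poly0 _ _) => l x; rewrite mulr0.
  + have /(corner_poly_monomial (inA_mul AG AG')) B :
      (a + b + (k + m) < d + d')%N by lia.
    by apply: corner_poly_ext B => l x; rewrite exprD mulrACA.
  + by apply: corner_poly_ext (corner_polyD BH1 BH2) => l x; rewrite mulrDr.
  + by apply: corner_poly_ext BH => l x; rewrite HH'.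
- by apply: corner_poly_ext (corner_polyD BH1 BH2) => l x; rewrite mulrDl.
- by apply: corner_poly_ext BH => l x; rewrite HH'.
Qed.

Lemma corner_poly_horner d (q : {poly R}) :
  (size q <= d)%N -> corner_poly d (fun _ x => q.[x]).
Proof.
move=> qd; apply: (corner_poly_ext (H' := fun _ x => \sum_(i < size q) q`_i * x ^+ i)).
  by move=> l x; rewrite horner_coef.
elim: (size q) qd => [|n IHn] ltnd.
  by apply: corner_poly_ext (corner_poly0 _ _) => l x; rewrite big_ord0.
have /(corner_poly_monomial (inA_const theta 0 q`_n)) B : (0 + n < d)%N by lia.
apply: corner_poly_ext (corner_polyD (IHn (ltnW ltnd)) B) => l x.
by rewrite big_ord_recr.
Qed.

End CornerPoly.

(** The leading coefficients cancel; this is where adding a box lowers the degree. *)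
Lemma size_sub_monic (K : nzRingType) (p q : {poly K}) (n : nat) :
  p \is monic -> q \is monic -> size p = n.+1 -> size q = n.+1 ->
  (size (p - q)%R <= n)%N.
Proof.
move=> /monicP pm /monicP qm sp sq; apply/leq_sizeP => j; rewrite leq_eqVlt.
case/predU1P => [<-|ltnj].
  by rewrite coefB; move: pm qm; rewrite /lead_coef sp sq /= => -> ->; rewrite subrr.
by rewrite coefB !nth_default ?subrr ?sp ?sq.
Qed.

(** Empty rows contribute 0, so diagrams with different numbers of rows can be compared over a
    common range. *)
Lemma pstar_widen (R : numFieldType) (theta : R) (m N : nat) (l : seq nat) :
  (size l <= N)%N ->
  pstar theta m l =
  \sum_(i < N) (((nth 0%N l i)%:R - theta * i.+1%:R) ^+ m
                - (- (theta * i.+1%:R)) ^+ m).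
Proof.
move=> lN; rewrite /pstar.
rewrite -!(big_mkord xpredT (fun i => ((nth 0%N l i)%:R - theta * i.+1%:R) ^+ m
  - (- (theta * i.+1%:R)) ^+ m)).
rewrite [RHS](big_cat_nat _ lN)//= -[LHS]addr0; congr (_ + _).
by rewrite big_nat_cond big1// => i /andP[/andP[li _] _]; rewrite nth_default// sub0r subrr.
Qed.

Lemma pstar_incr_nth (R : numFieldType) (theta : R) (m i : nat) (l : seq nat) :
  pstar theta m (incr_nth l i) =
  pstar theta m l
  + ((kx theta l i + 1 - theta) ^+ m - (kx theta l i - theta) ^+ m).
Proof.
have lN : (size l <= size (incr_nth l i))%N by rewrite size_incr_nth; case: ifP; lia.
have iN : (i < size (incr_nth l i))%N by rewrite size_incr_nth; case: ifP; lia.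
rewrite (pstar_widen theta m lN) /pstar.
rewrite [in LHS](bigD1 (Ordinal iN)) //= [in RHS](bigD1 (Ordinal iN)) //=.
rewrite (eq_bigr (fun j : 'I_(size (incr_nth l i)) =>
  ((nth 0%N l j)%:R - theta * j.+1%:R) ^+ m - (- (theta * j.+1%:R)) ^+ m)); last first.
  move=> j; rewrite -val_eqE /= eq_sym => /negbTE ji.
  by rewrite nth_incr_nth ji.
rewrite nth_incr_nth eqxx natrD /kx.
rewrite (_ : 1%:R + _ - theta * i.+1%:R =
  (nth 0%N l i)%:R - theta * i%:R + 1 - theta); last by rewrite [i.+1%:R]mulrSr; ring.
rewrite (_ : (nth 0%N l i)%:R - theta * i.+1%:R =
  (nth 0%N l i)%:R - theta * i%:R - theta); last by rewrite [i.+1%:R]mulrSr; ring.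
ring.
Qed.

(** The increment of a generator is a difference of two monic polynomials of degree m in the corner
    coordinate; products follow the discrete Leibniz rule. *)
Lemma inA_add_box (R : numFieldType) (theta : R) (d : nat) (F : seq nat -> R) :
  inA theta d F ->
  exists2 H, corner_poly theta d H &
    forall l i, F (incr_nth l i) = F l + H l (kx theta l i).
Proof.
elim=> {d F} [d c|m m0|d F G _ [H BH FH] _ [H' BH' GH']|d c F _ [H BH FH]
  |d d' F G AF [H BH FH] AG [H' BH' GH']|d d' F dd' _ [H BH FH]].
- exists (fun _ _ => 0); first exact: corner_poly0.
  by move=> l i; rewrite addr0.
- pose q : {poly R} := ('X - (theta - 1)%:P) ^+ m - ('X - theta%:P) ^+ m.
  exists (fun _ x => q.[x]).
    apply/corner_poly_horner/size_sub_monic; rewrite ?rpredX ?monicXsubC//;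
    by rewrite size_exp_XsubC.
  move=> l i; rewrite pstar_incr_nth /q !hornerE.
  by rewrite opprB addrA.
- exists (fun l x => H l x + H' l x); first exact: corner_polyD.
  by move=> l i; rewrite FH GH'; ring.
- exists (fun l x => c * H l x); last by move=> l i; rewrite FH mulrDr.
  exact: (corner_poly_mull (inA_const theta 0 c) BH).
- exists (fun l x => F l * H' l x + (G l * H l x + H l x * H' l x)).
    apply: corner_polyD; first exact: corner_poly_mull.
    apply: corner_polyD; last exact: corner_poly_mul.
    by rewrite addnC; apply: corner_poly_mull.
  by move=> l i; rewrite FH GH'; ring.
- by exists H => //; apply: corner_poly_mono BH.
Qed.

(* The filtration shifted by one, so that degree [-1] (the zero function) is
   index [0]. *)
Definition inA_below (R : numFieldType) (theta : R) (d : nat)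
    (F : seq nat -> R) : Prop :=
  if d is d'.+1 then inA_on_partitions theta d' F
  else forall l, is_partition l -> F l = 0.

(** Averaging turns x^k into h_k, which has degree at most k, so the bound on the total degree is
    kept. *)
Lemma corner_poly_average (R : realFieldType) (theta : R) (d : nat)
    (H : seq nat -> R -> R) :
  0 < theta -> corner_poly theta d H ->
  inA_below theta d
    (fun l => \sum_(i <- addable l) pi_up theta l i * H l (kx theta l i)).
Proof.
move=> th; elim=> {H} [|a k G AG|H H' _ AH _ AH'|H H' HH' _ AH'].
- case: d => [|d].
    by move=> l _; rewrite big1// => i _; rewrite mulr0.
  apply: (inAp_ext (G := fun=> 0)); last exact/inAp_inA/inA_const.
  by move=> l _; rewrite big1// => i _; rewrite mulr0.
- case: d => // d; rewrite ltnS => akd.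
  apply: (inAp_ext (G := fun l => G l * up_moment theta k l)).
    by move=> l _; rewrite /up_moment mulr_sumr; apply: eq_bigr => i _; ring.
  apply: (inAp_mono akd); apply: inAp_mul; first exact: inAp_inA.
  exact: inAp_up_moment.
- case: d AH AH' => [|d] AH AH'.
    move=> l pl; under eq_bigr do rewrite mulrDr.
    by rewrite big_split /= AH// AH'// addr0.
  apply: inAp_ext (inAp_add AH AH') => l _; rewrite -big_split /=.
  by apply: eq_bigr => i _; rewrite mulrDr.
- case: d AH' => [|d] AH'.
    by move=> l pl; rewrite -[RHS](AH' l pl); apply: eq_bigr => i _; rewrite HH'.
  by apply: inAp_ext AH' => l pl; apply: eq_bigr => i _; rewrite HH'.
Qed.

(** * Expectations *)

Lemma eq_expect (R : numFieldType) (theta : R) (n : nat) (F G : seq nat -> R) :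
  (forall l, is_partition l -> F l = G l) -> expect theta n F = expect theta n G.
Proof.
move=> FG; apply: eq_big_seq => l; rewrite mem_Yn => /andP[pl _].
by rewrite FG.
Qed.

Lemma expect_step (R : realFieldType) (theta : R) (d : nat) (F : seq nat -> R) :
  0 < theta -> inA_on_partitions theta d F ->
  exists2 G, inA_below theta d G &
    forall n, expect theta n.+1 F = expect theta n F + expect theta n G.
Proof.
move=> th [F' /inA_add_box[H BH F'H] FF'].
exists (fun l => \sum_(i <- addable l) pi_up theta l i * H l (kx theta l i)).
  exact: corner_poly_average.
move=> n; rewrite !(eq_expect _ _ FF') expectS /expect -big_split.
apply: eq_big_seq => l; rewrite mem_Yn => /andP[pl _] /=.
under eq_bigr do rewrite F'H mulrDr.
rewrite big_split /= -mulr_suml.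
(* The total weight 1 makes the average of the unchanged part equal to [F' l]. *)
rewrite (_ : \sum_(i <- addable l) pi_up theta l i = 1); first by ring.
by rewrite -(up_moment0 th pl); apply: eq_bigr => i _; rewrite mulr1.
Qed.

(** Discrete integration: (X+1)^(d+1) - X^(d+1) has leading term (d+1) X^d, so a multiple of it
    removes the top coefficient of [Q], and induction handles the rest. *)
Lemma poly_antidifference (K : numFieldType) (Q : {poly K}) (c : K) (d : nat) :
  (size Q <= d)%N ->
  exists P : {poly K}, [/\ (size P <= d.+1)%N, P.[0] = c &
    forall n : nat, P.[n.+1%:R] = P.[n%:R] + Q.[n%:R]].
Proof.
elim: d Q => [|d IHd] Q sQ.
  exists c%:P; split; rewrite ?hornerC// ?size_polyC_leq1//.
  by move=> n; rewrite !hornerC (size_poly_leq0P _ sQ) horner0 addr0.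
pose D : {poly K} := ('X + 1) ^+ d.+1 - 'X^(d.+1).
pose q := Q`_d / d.+1%:R.
have DE : D = \poly_(i < d.+1) 'C(d.+1, i)%:R.
  rewrite /D ['X + 1]addrC exprDn big_ord_recr /= subnn expr0 mul1r binn mulr1n.
  rewrite addrK poly_def; apply: eq_bigr => i _.
  by rewrite expr1n mul1r scaler_nat.
have sR : (size (Q - q *: D)%R <= d)%N.
  apply/leq_sizeP => j; rewrite leq_eqVlt coefB coefZ DE coef_poly => /predU1P[<-|ltdj].
    by rewrite ltnSn binSn divfK ?subrr// pnatr_eq0.
  by rewrite ltnS leqNgt ltdj mulr0 subr0 nth_default// (leq_trans sQ).
have [P [sP P0 PS]] := IHd _ sR; exists (P + q *: 'X^(d.+1)); split.
- apply: leq_trans (size_polyD _ _) _; rewrite geq_max (leqW sP) /=.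
  by apply: leq_trans (size_scale_leq _ _) _; rewrite size_polyXn.
- by rewrite !hornerE P0 expr0n mulr0 addr0.
- move=> n; have Dn : D.[n%:R] = n.+1%:R ^+ d.+1 - n%:R ^+ d.+1.
    by rewrite /D !hornerE -mulrSr.
  rewrite !hornerD !hornerZ PS hornerD hornerN hornerZ Dn !hornerXn; ring.
Qed.

(** The difference in n of the expectation of [F] is the expectation of a function one degree lower;
    it is summed from the value at n = 0. *)
Lemma expect_polynomial (R : realFieldType) (theta : R) (d : nat)
    (F : seq nat -> R) :
  0 < theta -> inA_below theta d F ->
  exists P : {poly R}, (size P <= d)%N /\
    forall n : nat, expect theta n F = P.[n%:R].
Proof.
move=> th; elim: d F => [|d IHd] F AF.
  exists 0; split; first by rewrite size_poly0.
  move=> n; rewrite (eq_expect _ _ AF) horner0 /expect big1// => l _.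
  exact: mul0r.
have [G /IHd[Q [sQ QE]] step] := expect_step th AF.
have [P [sP P0 PS]] := poly_antidifference (expect theta 0 F) sQ.
exists P; split=> //; elim=> [|n IHn]; first by rewrite P0.
by rewrite step IHn QE PS.
Qed.

Unset Implicit Arguments.

Theorem theorem6 (R : realFieldType) (theta : R) (htheta : 0 < theta)
  (d : nat) (F : seq nat -> R) :
  inA theta d F ->
  exists P : {poly R}, (size P <= d.+1)%N /\
    forall n : nat, expect theta n F = P.[n%:R].
Proof.
(* Degree at most [d] is index [d.+1] of [inA_below]. *)
by move=> AF; apply: expect_polynomial => //; apply: inAp_inA.
Qed.
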